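(* Let $\mathcal L^1$ be the relational language with an $3$-place symbol $\mathrm{App}_1$ and $(n+2)$-place symbols $\mathrm{Cmp}_{n,k}$ ($n,k\geq1$), and $\mathcal L^+$ the language obtained by adding $(n+2)$-place symbols $\mathrm{App}_n$ for all $n\geq2$. Then for every relation symbol $P$ of $\mathcal L^+$, of arity $m$, there is a first order $\mathcal L^1$-formula $\psi_P(x_1,\dots,x_m)$ such that for every semi-transitive clone $C$, $P^{\mathrm{Act}^+(C)}=\{\bar a\in|\mathrm{Act}^1(C)|^m : \mathrm{Act}^1(C)\models\psi_P[\bar a]\}$. That is, $\{\mathrm{Act}^+(C): C \text{ a semi-transitive clone}\}$ is definably interpretable in $\{\mathrm{Act}^1(C): C\text{ a semi-transitive clone}\}$.
   Context: A clone on a nonempty set $A$ is a set $C\subseteq\bigcup_{n\geq1}A^{A^n}$ containing all projections $p^A_{n,i}(x_1,\dots,x_n)=x_i$ and closed under composition ($f\in C\cap A^{A^n}$, $g_1,\dots,g_n\in C\cap A^{A^k}$ imply $\vec x\mapsto f(g_1(\vec x),\dots,g_n(\vec x))\in C$). Write $\mathrm{Fnc}_n(C)=C\cap A^{A^n}$. $\mathrm{Cmp}^C_{n,k}$ is the $(n+2)$-place relation of all $(f,g_1,\dots,g_n,h)$ with $f\in\mathrm{Fnc}_n(C)$, $g_i\in\mathrm{Fnc}_k(C)$, $h=f(g_1,\dots,g_n)$ pointwise; $\mathrm{App}^C_n$ is the $(n+2)$-place relation of all $(f,a_1,\dots,a_n,b)$ with $f\in\mathrm{Fnc}_n(C)$,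 $a_i,b\in A$, $f(a_1,\dots,a_n)=b$. $\mathrm{Act}^+(C)$ is the $\mathcal L^+$-structure with universe $C\cup A$ interpreting $\mathrm{App}_n$ as $\mathrm{App}^C_n$ and $\mathrm{Cmp}_{n,k}$ as $\mathrm{Cmp}^C_{n,k}$; $\mathrm{Act}^1(C)$ is its reduct to $\mathcal L^1$. A clone $C$ on $A$ is semi-transitive if for all $a,b\in A$ there are $c\in A$ and $f,g\in\mathrm{Fnc}_1(C)$ with $f(c)=a$ and $g(c)=b$. *)

(* Defs.v *)
From mathcomp Require Import all_boot.
Set Implicit Arguments.
Unset Strict Implicit.
Unset Printing Implicit Defensive.

Record language : Type := Language {
  symbol : Type;
  arity : symbol -> nat
}.

Record structure (L : language) : Type := Structure {
  universe :> Type;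
  interp : forall P : symbol L, ('I_(arity P) -> universe) -> Prop
}.

(** A formula of type [formula L n] has its free variables among
    [x_0, ..., x_(n-1)].  Quantifiers bind a fresh variable of index [0] and
    shift the remaining ones by one. *)
Inductive formula (L : language) : nat -> Type :=
| Eq n of 'I_n & 'I_n : formula L n
| Rel n (P : symbol L) of ('I_(arity P) -> 'I_n) : formula L n
| Bot n : formula L n
| And n of formula L n & formula L n : formula L n
| Or n of formula L n & formula L n : formula L n
| Imp n of formula L n & formula L n : formula L n
| All n of formula L n.+1 : formula L n
| Ex n of formula L n.+1 : formula L n.

Definition extend (T : Type) (n : nat) (x : T) (v : 'I_n -> T) : 'I_n.+1 -> T :=
  fun i => oapp v x (unlift ord0 i).

Fixpoint satisfies (L : language) (M : structure L) (n : nat)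
    (phi : formula L n) : ('I_n -> M) -> Prop :=
  match phi in formula _ n return ('I_n -> M) -> Prop with
  | Eq _ i j => fun v => v i = v j
  | Rel _ P t => fun v => interp (fun i => v (t i))
  | Bot _ => fun _ => False
  | And _ p q => fun v => satisfies p v /\ satisfies q v
  | Or _ p q => fun v => satisfies p v \/ satisfies q v
  | Imp _ p q => fun v => satisfies p v -> satisfies q v
  | All _ p => fun v => forall x : M, satisfies p (extend x v)
  | Ex _ p => fun v => exists x : M, satisfies p (extend x v)
  end.

Definition sublanguage (L : language) (S : Type) (i : S -> symbol L) : language :=
  @Language S (fun s => arity (i s)).

Definition reduct (L : language) (S : Type) (i : S -> symbol L)
    (M : structure L) : structure (sublanguage i) :=
  @Structure (sublanguage i) M (fun s => @interp L M (i s)).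

Definition op (A : Type) (n : nat) : Type := ('I_n -> A) -> A.

Record clone (A : Type) : Type := Clone {
  clone_mem :> forall n, op A n -> Prop;
  clone_arity_gt0 : forall n (f : op A n), clone_mem f -> 0 < n;
  clone_proj : forall n (i : 'I_n), clone_mem (fun x : 'I_n -> A => x i);
  clone_comp : forall n k (f : op A n) (g : 'I_n -> op A k),
    clone_mem f -> (forall i, clone_mem (g i)) ->
    clone_mem (fun x : 'I_k -> A => f (fun i => g i x))
}.

Definition Fnc (A : Type) (C : clone A) (n : nat) : Type := {f : op A n | C n f}.

Definition apply (A : Type) (C : clone A) (n : nat) (f : Fnc C n) : op A n :=
  sval f.

Definition semi_transitive (A : Type) (C : clone A) : Prop :=
  forall a b : A, exists (c : A) (f g : Fnc C 1),
    apply f (fun _ => c) = a /\ apply g (fun _ => c) = b.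

Inductive Lplus_symbol : Type :=
| App n of 0 < n
| Cmp n k of 0 < n & 0 < k.

Definition Lplus : language :=
  @Language Lplus_symbol
    (fun P => match P with App n _ => n.+2 | Cmp n _ _ _ => n.+2 end).

Inductive L1_symbol : Type :=
| L1_App1
| L1_Cmp n k of 0 < n & 0 < k.

Definition L1_incl (P : L1_symbol) : symbol Lplus :=
  match P with
  | L1_App1 => App (ltn0Sn 0)
  | L1_Cmp n k hn hk => Cmp hn hk
  end.

Definition L1 : language := sublanguage L1_incl.

(** The union of [C] and [A] is disjoint in set theory by the axiom of
    foundation, and operations of different arities are distinct since [A] is
    nonempty; hence a sum, with each operation tagged by its arity. *)
Definition act_universe (A : Type) (C : clone A) : Type :=
  ({n : nat & Fnc C n} + A)%type.

Definition fn (A : Type) (C : clone A) (n : nat) (f : Fnc C n) : act_universe C :=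
  inl (existT _ n f).

Definition el (A : Type) (C : clone A) (a : A) : act_universe C := inr a.

(** [is_tuple v x y z] means that [v] is the tuple [(x, y_1, ..., y_n, z)]. *)
Definition is_tuple (T : Type) (n : nat) (v : 'I_n.+2 -> T)
    (x : T) (y : 'I_n -> T) (z : T) : Prop :=
  [/\ v ord0 = x,
      forall i : 'I_n, v (lift ord0 (lift ord_max i)) = y i
    & v ord_max = z].

Definition App_rel (A : Type) (C : clone A) (n : nat)
    (v : 'I_n.+2 -> act_universe C) : Prop :=
  exists (f : Fnc C n) (a : 'I_n -> A) (b : A),
    is_tuple v (fn f) (fun i => el C (a i)) (el C b) /\ apply f a = b.

Definition Cmp_rel (A : Type) (C : clone A) (n k : nat)
    (v : 'I_n.+2 -> act_universe C) : Prop :=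
  exists (f : Fnc C n) (g : 'I_n -> Fnc C k) (h : Fnc C k),
    is_tuple v (fn f) (fun i => fn (g i)) (fn h) /\
    forall x : 'I_k -> A, apply h x = apply f (fun i => apply (g i) x).

Definition Act_plus (A : Type) (C : clone A) : structure Lplus :=
  @Structure Lplus (act_universe C)
    (fun P => match P with
              | App n _ => @App_rel A C n
              | Cmp n k _ _ => @Cmp_rel A C n k
              end).

Definition Act1 (A : Type) (C : clone A) : structure L1 :=
  reduct L1_incl (Act_plus C).

(* Main.v *)
(** Iterating semi-transitivity, finitely many points a_1, ..., a_n of A have a
    common preimage: there are c and unary g_i in C with g_i(c) = a_i.  Hence
    f(a_1, ..., a_n) = b iff for some such c, g_1, ..., g_n the unary operation
    h = f(g_1, ..., g_n) satisfies h(c) = b, and the latter only mentions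
    App_1 and Cmp_(n,1). *)
Require Import Defs.
From mathcomp Require Import all_boot.
From Stdlib Require Import FunctionalExtensionality Eqdep_dec Setoid.

Set Implicit Arguments.
Unset Strict Implicit.
Unset Printing Implicit Defensive.

Lemma extend0 (T : Type) n (x : T) (v : 'I_n -> T) : extend x v ord0 = x.
Proof. by rewrite /extend unlift_none. Qed.

Lemma extend_lift (T : Type) n (x : T) (v : 'I_n -> T) i :
  extend x v (lift ord0 i) = v i.
Proof. by rewrite /extend liftK. Qed.

Lemma comp_extend (T U : Type) (f : T -> U) n x (v : 'I_n -> T) :
  (fun i => f (extend x v i)) = extend (f x) (fun i => f (v i)).
Proof.
apply: functional_extensionality => i.
by case: (unliftP ord0 i) => [j ->|->]; rewrite ?extend0 ?extend_lift.
Qed.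

Definition triple (T : Type) (x y z : T) (i : 'I_3) : T := nth x [:: x; y; z] i.

Lemma comp_triple (T U : Type) (f : T -> U) x y z :
  (fun i => f (triple x y z i)) = triple (f x) (f y) (f z).
Proof.
by apply: functional_extensionality => -[[|[|[|]]]].
Qed.

Lemma lift0_max n : lift ord0 (@ord_max n) = ord_max.
Proof. exact: val_inj. Qed.

(** The valuation met under a block of quantifiers: since [Ex] binds index 0 and shifts the others,
    the bound tuple [w] precedes the free one [v]. *)
Definition join_val (T : Type) m n (w : 'I_m -> T) (v : 'I_n -> T)
    (i : 'I_(m + n)) : T :=
  match split i with inl j => w j | inr j => v j end.

Lemma join_val_lshift (T : Type) m n (w : 'I_m -> T) (v : 'I_n -> T) j :
  join_val w v (lshift n j) = w j.
Proof. by rewrite /join_val (unsplitK (inl j)). Qed.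

Lemma join_val_rshift (T : Type) m n (w : 'I_m -> T) (v : 'I_n -> T) j :
  join_val w v (rshift m j) = v j.
Proof. by rewrite /join_val (unsplitK (inr j)). Qed.

Lemma join_val0 (T : Type) n (w : 'I_0 -> T) (v : 'I_n -> T) :
  join_val w v = v.
Proof.
apply: functional_extensionality => i.
rewrite -[RHS](join_val_rshift w); congr join_val; exact: val_inj.
Qed.

(** Lets a quantifier be absorbed into a block: the newest bound value becomes the head of the bound
    tuple. Both sides have the same domain because [m.+1 + n] computes to [(m + n).+1]. *)
Lemma join_val_extend (T : Type) m n x (w : 'I_m -> T) (v : 'I_n -> T) :
  join_val (extend x w) v = extend x (join_val w v).
Proof.
apply: functional_extensionality => i.
case: (unliftP ord0 i) => [j ->|->]; rewrite ?extend0 ?extend_lift.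
  rewrite -(splitK j); case: (split j) => k /=.
    have -> : lift ord0 (lshift n k) = lshift n (lift ord0 k) by exact: val_inj.
    by rewrite !join_val_lshift extend_lift.
  have -> : lift ord0 (rshift m k) = rshift m.+1 k by exact: val_inj.
  by rewrite !join_val_rshift.
have -> : ord0 = lshift n (@ord0 m) by exact: val_inj.
by rewrite join_val_lshift extend0.
Qed.

Section Formulas.

Variables (L : language) (M : structure L).

(** Variable 0 belongs to the innermost quantifier, so the block is built from the inside out. *)
Fixpoint exs m n : formula L (m + n) -> formula L n :=
  match m with
  | 0 => id
  | m'.+1 => fun phi => @exs m' n (Ex phi)
  end.

Lemma satisfies_exs m n (phi : formula L (m + n)) (v : 'I_n -> M) :
  satisfies (exs phi) v <->
  exists w : 'I_m -> M, satisfies phi (join_val w v).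
Proof.
elim: m phi => [|m IHm] phi /=.
  split=> [Hv|[w]]; last by rewrite join_val0.
  have w (i : 'I_0) : M by case: i.
  by exists w; rewrite join_val0.
rewrite IHm /=; split=> [[w [x Hx]]|[w Hw]].
  by exists (extend x w); rewrite join_val_extend.
exists (fun i => w (lift ord0 i)), (w ord0); rewrite -join_val_extend.
suff -> : extend (w ord0) (fun i => w (lift ord0 i)) = w by [].
apply: functional_extensionality => i.
by case: (unliftP ord0 i) => [j ->|->]; rewrite ?extend0 ?extend_lift.
Qed.

(** The empty conjunction [Imp Bot Bot] stands for truth, which is not a primitive formula. *)
Definition ands n (I : finType) (F : I -> formula L n) : formula L n :=
  foldr (fun i phi => And (F i) phi) (Imp (Bot L n) (Bot L n)) (enum I).

Lemma satisfies_ands n (I : finType) (F : I -> formula L n) (v : 'I_n -> M) :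
  satisfies (ands F) v <-> forall i, satisfies (F i) v.
Proof.
suff H s : satisfies (foldr (fun i phi => And (F i) phi)
                       (Imp (Bot L n) (Bot L n)) s) v
             <-> forall i, i \in s -> satisfies (F i) v.
  rewrite H; split=> [Hs i|Hs i _]; last exact: Hs.
  by apply: Hs; rewrite mem_enum.
elim: s => [|i s IHs] //=; rewrite IHs; split=> [[Hi Hs] j|Hs].
  by rewrite inE => /predU1P[->|/Hs].
split=> [|j js]; apply: Hs; first exact: mem_head.
by rewrite inE js orbT.
Qed.

End Formulas.

Section Clones.

Variables (A : Type) (C : clone A).

(** Arities are natural numbers, whose equality is decidable, so equal tagged pairs have equal
    second components. *)
Lemma fn_inj n : injective (@fn A C n).
Proof. by move=> f g [fg]; apply: inj_pair2_eq_dec fg; exact: eq_comparable. Qed.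

(** Induction on [n]: if the [g i] send c' to the tail of [a], and p, q send c to c' and to the head
    of [a], then q and the composites of the [g i] with p work at c. For [n = 0] any point of the
    inhabited [A] serves. *)
Lemma common_preimage (hA : inhabited A) (hC : semi_transitive C) n
    (a : 'I_n -> A) :
  exists (c : A) (g : 'I_n -> Fnc C 1), forall i, apply (g i) (fun=> c) = a i.
Proof.
elim: n a => [|n IHn] a.
  case: hA => c; exists c.
  by exists (fun=> exist _ _ (clone_proj C (@ord0 0))) => -[].
have [c' [g gE]] := IHn (fun i => a (lift ord0 i)).
have [c [p [q [pE qE]]]] := hC c' (a ord0).
pose gp i : Fnc C 1 :=
  exist _ _ (clone_comp (proj2_sig (g i)) (fun _ : 'I_1 => proj2_sig p)).
exists c, (extend q gp) => i.
case: (unliftP ord0 i) => [j ->|->]; rewrite ?extend0 ?extend_lift //.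
by rewrite -gE -pE.
Qed.

(** Every tuple indexed by ['I_1] is constant, so a unary application is determined by an operation
    and one point. *)
Lemma App_rel1P (x y z : act_universe C) :
  App_rel (n := 1) (triple x y z) <->
  exists (g : Fnc C 1) (c : A),
    [/\ x = fn g, y = el C c & z = el C (apply g (fun=> c))].
Proof.
split=> [[g [a [b [[xE yE zE] fab]]]]|[g [c [-> -> ->]]]].
  exists g, (a ord0); split=> //; first exact: yE ord0.
  rewrite -fab in zE.
  have <- : a = fun=> a ord0; last exact: zE.
  by apply: functional_extensionality => i; rewrite (ord1 i).
exists g, (fun=> c), (apply g (fun=> c)); split=> //.
by split=> // i; rewrite (ord1 i).
Qed.

End Clones.

(* The quantified tuple is w = (c, g_1, ..., g_n, h) and the free one is
   v = (f, a_1, ..., a_n, b): the conjuncts say Cmp(f, g, h), and that the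
   entries of w beyond c send c to the matching entries of v. *)
Definition App_formula n (hn : 0 < n) : formula L1 n.+2 :=
  exs (m := n.+2)
    (And
      (@Rel L1 _ (L1_Cmp hn (ltn0Sn 0))
        (extend (rshift n.+2 ord0) (fun i => lshift n.+2 (lift ord0 i))))
      (ands (fun i : 'I_n.+1 => @Rel L1 _ L1_App1
        (triple (lshift n.+2 (lift ord0 i)) (lshift n.+2 ord0)
                (rshift n.+2 (lift ord0 i)))))).

(** Removes the syntax. The entries of [w] range over the whole universe; it is the relations that
    force them to be operations or points. *)
Lemma satisfies_App_formula (A : Type) (C : clone A) n (hn : 0 < n)
    (v : 'I_n.+2 -> Act1 C) :
  satisfies (App_formula hn) v <->
  exists w : 'I_n.+2 -> act_universe C,
    @Cmp_rel A C n 1 (extend (v ord0) (fun i => w (lift ord0 i))) /\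
    forall i : 'I_n.+1,
      App_rel (n := 1) (triple (w (lift ord0 i)) (w ord0) (v (lift ord0 i))).
Proof.
rewrite satisfies_exs.
have Hc (w : 'I_n.+2 -> act_universe C) :
    (fun i => join_val w v (extend (rshift n.+2 ord0)
                      (fun i => lshift n.+2 (lift ord0 i)) i))
    = extend (v ord0) (fun i => w (lift ord0 i)).
  rewrite comp_extend join_val_rshift; congr extend.
  by apply: functional_extensionality => i; rewrite join_val_lshift.
have Ha (w : 'I_n.+2 -> act_universe C) (i : 'I_n.+1) :
    (fun j => join_val w v (triple (lshift n.+2 (lift ord0 i))
                (lshift n.+2 ord0) (rshift n.+2 (lift ord0 i)) j))
    = triple (w (lift ord0 i)) (w ord0) (v (lift ord0 i)).
  by rewrite comp_triple !join_val_lshift join_val_rshift.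
split=> -[w [Hw Hi]]; exists w; split.
- by rewrite -Hc.
- by move=> i; rewrite -Ha; apply: (satisfies_ands _ _).1 Hi i.
- by rewrite -Hc in Hw.
- by apply/satisfies_ands => i; move: (Hi i); rewrite -Ha.
Qed.

Lemma App_relE (A : Type) (hA : inhabited A) (C : clone A)
    (hC : semi_transitive C) n (hn : 0 < n) (v : 'I_n.+2 -> Act1 C) :
  App_rel (n := n) v <-> satisfies (App_formula hn) v.
Proof.
rewrite satisfies_App_formula; split.
  move=> [f [a [b [[fE aE bE] fab]]]].
  have [c [g gE]] := common_preimage hA hC a.
  pose h : Fnc C 1 :=
    exist _ _ (clone_comp (proj2_sig f) (fun i => proj2_sig (g i))).
  have hE : apply h (fun=> c) = b.
    rewrite -fab; congr (apply f).
    exact: functional_extensionality gE.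
  (* The tuple (c, g_1, ..., g_n, h): at [ord_max] the function [unlift] returns [None], so the
     default [h] of [oapp] fills the last place. *)
  exists (extend (el C c) (fun i => fn (oapp g h (unlift ord_max i)))).
  split=> [|i].
    exists f, g, h; split=> //; split=> [|i|].
    - by rewrite extend0.
    - by rewrite !extend_lift liftK.
    - by rewrite -lift0_max !extend_lift unlift_none.
  rewrite extend0 extend_lift; apply/App_rel1P.
  exists (oapp g h (unlift ord_max i)), c; split=> //.
  case: (unliftP ord_max i) => [j ->|->] /=; first by rewrite gE aE.
  by move: hE => /= ->; rewrite lift0_max.
move=> [w [[f [g [h [[fE gE hE] hfg]]]] Hw]].
(* The last conjunct shows that the head of [w] is a point c and that b is the value there of some
   h', which [fn_inj] identifies with the composite h. *)
have /App_rel1P[h' [c [wh wc vb]]] := Hw ord_max.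
rewrite extend0 in fE.
rewrite -lift0_max extend_lift in hE.
have hh' : h' = h by apply: fn_inj; rewrite -wh.
exists f, (fun i => apply (g i) (fun=> c)), (apply h (fun=> c)).
split; last by rewrite hfg.
split=> // [i|]; last by rewrite -lift0_max vb hh'.
(* Each remaining conjunct brings its own operation and point; injectivity of the two inclusions
   into the universe identifies them with [g i] and [c]. *)
have /App_rel1P[gi [c' [wg wc' ->]]] := Hw (lift ord_max i).
have /fn_inj<- : fn gi = fn (g i) by rewrite -gE extend_lift.
by move: wc'; rewrite wc => -[->].
Qed.

Theorem theorem10p1 (P : symbol Lplus) :
  exists psi : formula L1 (arity P),
    forall (A : Type) (hA : inhabited A) (C : clone A),
      semi_transitive C ->
      forall a : 'I_(arity P) -> Act1 C,
        interp (s := Act_plus C) (P := P) a <-> satisfies psi a.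
Proof.
case: P => [n hn|n k hn hk].
  by exists (App_formula hn) => A hA C hC a; apply: App_relE.
(* A composition symbol already lies in the smaller language, and the reduct interprets it by the
   same relation, so the atomic formula on the variables in order defines it. *)
by exists (@Rel L1 _ (L1_Cmp hn hk) id).
Qed.
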